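(* Consider the Bruin--Troubetzkoy family $\mathcal T_{a,b}$ of maps $T_{a,b}:[0,1)\to[0,1)$ with $0\le b\le a\le1$. Stable maps are dense in this family: the set of parameters $(a,b)$ for which $T_{a,b}$ is stable (within the family) is dense in $\{(a,b):0\le b\le a\le 1\}$.
   Context: For $0\le b\le a\le1$ the map $T_{a,b}:[0,1)\to[0,1)$ is $$T_{a,b}(x)=\begin{cases}x+a,& x\in[0,1-a),\\ x+b,& x\in[1-a,1-b),\\ x+b-1,& x\in[1-b,1).\end{cases}$$ It is an interval translation mapping on three intervals with discontinuities $\beta_1=1-a$, $\beta_2=1-b$. Put $I=[0,1)$ and $X(T)=\bigcap_{n\ge0}T^n(I)$. A map $T=T_{a,b}$ is stable within the family if there is a neighbourhood $\mathcal U$ of $T$ in the family (i.e. of $(a,b)$ in the parameter triangle) such that: (1) $\tilde T\mapsto\overline{X(\tilde T)}$ is continuous on $\mathcal U$ in the Hausdorff topology on compact sets, and $\overline{X(\tilde T)}$ is homeomorphic to $\overline{X(T)}$ for each $\tilde T\in\mathcal U$; (2) the number of discontinuities of $\tilde T$ lying in $I\setminus\overline{X(\tilde T)}$ is constant for $\tilde T\in\mathcal U$. *)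

(* Defs.v *)
From HB Require Import structures.
From mathcomp Require Import all_boot all_order all_algebra.
From mathcomp Require Import all_classical all_reals all_analysis.

Set Implicit Arguments.
Unset Strict Implicit.
Unset Printing Implicit Defensive.

Import Order.TTheory GRing.Theory Num.Theory.
Import numFieldNormedType.Exports.

Local Open Scope classical_set_scope.
Local Open Scope ring_scope.

Definition triangle {R : realType} : set (R * R) :=
  [set p | 0 <= p.2 /\ p.2 <= p.1 /\ p.1 <= 1].

Definition unit_itv {R : realType} : set R := [set` `[0, 1[ ].

(* Only the values on [unit_itv] matter; for p = (a, b) in [triangle] this maps
   [unit_itv] to itself. *)
Definition bt_map (R : realType) (p : R * R) (x : R) : R :=
  if x < 1 - p.1 then x + p.1
  else if x < 1 - p.2 then x + p.2
  else x + p.2 - 1.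

Definition attractor (R : realType) (p : R * R) : set R :=
  \bigcap_(n in [set: nat]) (iter n (bt_map p) @` unit_itv).

(* Basic entourage of the Hausdorff uniformity. On nonempty compact sets this
   is the uniformity of the Hausdorff distance; the empty set is isolated. *)
Definition hausdorff_close (R : realType) (e : R) (A B : set R) : Prop :=
  A `<=` \bigcup_(y in B) ball y e /\ B `<=` \bigcup_(x in A) ball x e.

Definition hausdorff_continuous_on (R : realType) (U : set (R * R))
    (K : R * R -> set R) : Prop :=
  forall p, U p -> forall e : R, 0 < e ->
    \forall q \near within U (nbhs p), hausdorff_close e (K p) (K q).

(* A and B carry their subspace topologies. *)
Definition homeomorphic (S T : topologicalType) (A : set S) (B : set T) : Prop :=
  exists (f : S -> T) (g : T -> S),
    [/\ f @` A `<=` B, g @` B `<=` A,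
        (forall x, A x -> g (f x) = x) & (forall y, B y -> f (g y) = y)] /\
    {within A, continuous f} /\ {within B, continuous g}.

(* Continuity is relative to [unit_itv], so 0 is never a discontinuity. For
   0 < b < a < 1 the discontinuities are exactly 1 - a and 1 - b. *)
Definition discontinuities (R : realType) (p : R * R) : set R :=
  [set x | unit_itv x /\
    ~ (bt_map p y @[y --> within unit_itv (nbhs x)] --> bt_map p x)].

Definition stable (R : realType) (p : R * R) : Prop :=
  exists U : set (R * R),
    [/\ U `<=` triangle, within triangle (nbhs p) U,
        hausdorff_continuous_on U (fun q => closure (attractor q)),
        (forall q, U q ->
           homeomorphic (closure (attractor q)) (closure (attractor p))) &
        exists k : nat, forall q, U q ->
          (discontinuities q `&` (unit_itv `\` closure (attractor q))
             #= `I_k)%card].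

(* Main.v *)
Require Import Defs.
From mathcomp Require Import all_boot all_order all_algebra.
From mathcomp Require Import all_classical all_reals all_analysis.
From mathcomp Require Import ring lra.
Import Order.TTheory GRing.Theory Num.Theory.
Import numFieldNormedType.Exports.
Local Open Scope classical_set_scope.
Local Open Scope ring_scope.

(** The first-return map of T_(a,b) to [1 - a, 1), rescaled to the unit
    interval, is again a member of the family: its parameter is
    G_k(a, b) = (b / a, (b - 1) / a + k) with k = floor (1 / a)
    ([return_map_chart], [return_map_iter]).  This holds even when the second
    coordinate of G_k(a, b) is negative, provided the same formula is used for
    the map; so the parameters considered are those with 0 < a < 1 and
    a - 1 < b < a.  Once b < 0 nothing is left to renormalize: the map has two
    branches and is eventually a rotation of [1 - a + b, 1), which is its
    attractor ([attractor_flip]).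

    Stability.  The attractor of T_p is recovered from that of its
    renormalization by pushing it along the orbit: below 1 - a each point has
    at most one preimage, so the attractor of T_p there consists of translates
    by multiples of a of one piece of it, the last one cut off at 1 - a
    ([attractor_renorm_level]).  Hence an
    increasing homeomorphism of the line that carries the attractor of one
    renormalized map to that of another, and respects the discontinuities, can
    be spread over the orbit to do the same for the maps themselves
    ([conjugacy_renorm]).  On the open set b < 0 such homeomorphisms are
    piecewise affine and tend to the identity as the parameters come together
    ([conj_family_flip]); this convergence survives the spreading
    ([conj_family_renorm]).  Therefore, over any open set of parameters whose
    renormalizations all end, along the same values of k, in b < 0, the closed
    attractors are carried to one another by ambient homeomorphisms close to
    the identity that match the discontinuities.  This gives all the conditions
    of stability at once ([stable_renormalizable]).

    Density.  The map G_k has a continuous right inverse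
    H_k(a, b) = (1 / (k + a - b), a / (k + a - b)), so the closure of the set
    of terminating parameters is invariant under the maps H_k
    ([closure_unrenorm]).  Writing a rational point as (y / x, z / x), the
    renormalization is the subtractive step
    (x, y, z) |-> (y, z, z - (x mod y)), which strictly decreases positive
    integer triples except at x = y = z.  So every rational point is an image
    under finitely many H_k either of a point in the closure of b < 0 or of the
    corner (1, 1), and the corner is the limit of the terminating points
    H_1^n(1/3, -1/3) ([closure_corner], [closure_rational]). *)

(** * Iterated ranges and the attractor *)

Definition range_at {R : realType} (p : R * R) (n : nat) : set R :=
  iter n (bt_map p) @` unit_itv.

(** The formula of the family maps [0, 1) to itself also for a - 1 < b < 0,
    where the third branch is empty. *)
Definition bt_domain {R : realType} : set (R * R) :=
  [set p | [/\ 0 < p.1, p.1 < 1, p.1 - 1 < p.2 & p.2 < p.1]].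

Lemma unit_itvE (R : realType) (x : R) : unit_itv x <-> 0 <= x /\ x < 1.
Proof. by rewrite /unit_itv /= in_itv /=; split=> /andP. Qed.

Lemma bt_map_unit (R : realType) (p : R * R) (x : R) :
  bt_domain p -> unit_itv x -> unit_itv (bt_map p x).
Proof.
move=> [a0 a1 ab ba] /unit_itvE[x0 x1]; apply/unit_itvE; rewrite /bt_map.
by case: ltP => h1; [|case: ltP => h2]; split; lra.
Qed.

Lemma iter_bt_map_unit (R : realType) (p : R * R) (n : nat) (x : R) :
  bt_domain p -> unit_itv x -> unit_itv (iter n (bt_map p) x).
Proof. by move=> Dp Ix; elim: n => //= n; apply: bt_map_unit. Qed.

Lemma range_atS (R : realType) (p : R * R) (n : nat) (x : R) :
  range_at p n.+1 x <-> exists2 y, range_at p n y & bt_map p y = x.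
Proof.
split=> [[y Iy <-]|[_ [y Iy <-] <-]]; last by exists y.
by exists (iter n (bt_map p) y) => //; exists y.
Qed.

Lemma range_at_unit (R : realType) (p : R * R) (n : nat) (x : R) :
  bt_domain p -> range_at p n x -> unit_itv x.
Proof. by move=> Dp [y Iy <-]; apply: iter_bt_map_unit. Qed.

Lemma iter_range_at (R : realType) (p : R * R) (m n : nat) (x : R) :
  range_at p n x -> range_at p (m + n) (iter m (bt_map p) x).
Proof. by case=> y Iy <-; exists y => //; rewrite iterD. Qed.

Lemma range_at_leq (R : realType) (p : R * R) (m n : nat) :
  bt_domain p -> (m <= n)%N -> range_at p n `<=` range_at p m.
Proof.
move=> Dp mn _ [y Iy <-]; rewrite -(subnKC mn) iterD.
by exists (iter (n - m) (bt_map p) y) => //; apply: iter_bt_map_unit.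
Qed.

Lemma attractorE (R : realType) (p : R * R) (x : R) :
  attractor p x <-> forall n, range_at p n x.
Proof. by split=> [h n|h n _]; [exact: h | exact: h]. Qed.

Lemma attractor_unit (R : realType) (p : R * R) : attractor p `<=` unit_itv.
Proof. by move=> x /attractorE/(_ 0%N)[y Iy <-]. Qed.

(** * Renormalization by the first return to [1 - a, 1) *)

Definition renorm {R : realType} (k : nat) (p : R * R) : R * R :=
  (p.2 / p.1, (p.2 - 1) / p.1 + k%:R).

Definition return_chart {R : realType} (p : R * R) (t : R) : R :=
  1 - p.1 + p.1 * t.

(** A point entering [0, b) at y = x + b - 1 climbs by steps of a until it is at
    least 1 - a.  With 1 = k a + r this takes k steps when y < r and k - 1 steps
    otherwise. *)
Definition return_map {R : realType} (k : nat) (p : R * R) (x : R) : R :=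
  if x < 1 - p.2 then x + p.2
  else if x < 1 - p.2 + (1 - k%:R * p.1) then x + p.2 - 1 + k%:R * p.1
  else x + p.2 - 1 + k%:R * p.1 - p.1.

Lemma renorm_eqs (R : realType) (k : nat) (p : R * R) : 0 < p.1 ->
  p.1 * (renorm k p).1 = p.2 /\
  p.1 * (renorm k p).2 = p.2 - 1 + k%:R * p.1.
Proof.
by move=> a0; rewrite /renorm /=; split; field; rewrite gt_eqF.
Qed.

(** The last two bounds say that k = floor (1 / a) and that 1 is not a multiple
    of a. *)
Lemma renorm_domain (R : realType) (k : nat) (p : R * R) :
  (0 < k)%N -> 0 < p.1 -> bt_domain (renorm k p) ->
  [/\ 0 < p.2, p.2 < p.1, p.1 < 1, 0 < 1 - k%:R * p.1 & 1 - k%:R * p.1 < p.1].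
Proof.
move=> k0 a0 [q1 q2 q3 q4]; have [e1 e2] := renorm_eqs R k p a0.
have k1 : (1 : R) <= k%:R by rewrite ler1n.
move: q1 q2 q3 q4 e1 e2.
set a' := (renorm k p).1; set b' := (renorm k p).2 => q1 q2 q3 q4 e1 e2.
have h1 := mulr_gt0 a0 q1.
have h2 : 0 < p.1 * (1 - a') by apply: mulr_gt0 => //; lra.
have h3 : 0 < p.1 * (b' - (a' - 1)) by apply: mulr_gt0 => //; lra.
have h4 : 0 < p.1 * (a' - b') by apply: mulr_gt0 => //; lra.
have h5 : 0 <= p.1 * (k%:R - 1) by apply: mulr_ge0; lra.
split; lra.
Qed.

Lemma renorm_bt_domain (R : realType) (k : nat) (p : R * R) :
  (0 < k)%N -> 0 < p.1 -> bt_domain (renorm k p) -> bt_domain p.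
Proof.
by move=> k0 a0 Dq; have [? ? ? ? ?] := renorm_domain R k p k0 a0 Dq; split; lra.
Qed.

(** The return map is affinely conjugate to the map with renormalized parameter:
    its two cuts 1 - b and 1 - b + r are the images under the chart of the two
    discontinuities of that map. *)
Lemma return_map_chart (R : realType) (k : nat) (p : R * R) (t : R) :
  0 < p.1 ->
  return_chart p (bt_map (renorm k p) t) = return_map k p (return_chart p t).
Proof.
move=> a0; have [e1 e2] := renorm_eqs R k p a0.
rewrite /bt_map /return_map /return_chart.
move: e1 e2; set a' := (renorm k p).1; set b' := (renorm k p).2 => e1 e2.
have -> : (t < 1 - a') = (1 - p.1 + p.1 * t < 1 - p.2).
  by rewrite -(ltr_pM2l a0) mulrBr e1; apply/idP/idP; lra.
have -> : (t < 1 - b') = (1 - p.1 + p.1 * t < 1 - p.2 + (1 - k%:R * p.1)).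
  by rewrite -(ltr_pM2l a0) mulrBr e2; apply/idP/idP; lra.
by case: ifP => _; [|case: ifP => _]; lra.
Qed.

Lemma return_chartP (R : realType) (p : R * R) (x : R) : 0 < p.1 ->
  1 - p.1 <= x -> x < 1 -> exists2 t, unit_itv t & return_chart p t = x.
Proof.
move=> a0 x1 x2; exists ((x - 1 + p.1) / p.1); last first.
  by rewrite /return_chart; field; rewrite gt_eqF.
apply/unit_itvE; split; first by rewrite divr_ge0 //; lra.
by rewrite ltr_pdivrMr //; lra.
Qed.

Lemma iter_bt_map_shift (R : realType) (p : R * R) (j : nat) (y : R) :
  (forall i, (i < j)%N -> y + i%:R * p.1 < 1 - p.1) ->
  iter j (bt_map p) y = y + j%:R * p.1.
Proof.
elim: j => [|j IH] h; first by rewrite /= mul0r addr0.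
rewrite /= IH; last by move=> i ij; apply: h; rewrite ltnS ltnW.
by rewrite /bt_map h // -natr1; ring.
Qed.

Lemma return_map_iter (R : realType) (k : nat) (p : R * R) (x : R) :
  (0 < k)%N -> 0 < p.1 -> bt_domain (renorm k p) -> 1 - p.1 <= x -> x < 1 ->
  exists m, iter m.+1 (bt_map p) x = return_map k p x.
Proof.
move=> k0 a0 Dq x0 x1.
have [b0 ba a1 r0 ra] := renorm_domain R k p k0 a0 Dq.
have k1 : (1 : R) <= k%:R by rewrite ler1n.
rewrite /return_map; case: ltP => xb.
  by exists 0%N; rewrite /= /bt_map xb ltNge x0.
have Tx : bt_map p x = x + p.2 - 1.
  by rewrite /bt_map !ltNge x0 xb.
have lk (i m : nat) : (i < m)%N -> i%:R * p.1 + p.1 <= m%:R * p.1.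
  move=> im; have : i.+1%:R * p.1 <= m%:R * p.1.
    by rewrite ler_pM2r // ler_nat.
  by rewrite -natr1; lra.
case: ltP => xr.
  exists k; rewrite iterSr Tx iter_bt_map_shift // => i /lk; lra.
exists k.-1; rewrite iterSr Tx iter_bt_map_shift.
  by rewrite -{2}(prednK k0) -natr1; ring.
move=> i ik; have := lk i.+1 k; rewrite -natr1.
have ->: (i.+1 < k)%N by case: (k) k0 ik.
by move=> /(_ isT); lra.
Qed.

(** Backward orbits below 1 - a are unique: x in [a, 1 - a) can only come from
    x - a, a point of [0, b) only from x + 1 - b, and a point of [b, a) has no
    preimage at all. *)
Lemma range_at_level (R : realType) (p : R * R) (j n : nat) (y : R) :
  0 < p.2 -> p.2 < p.1 -> p.1 < 1 -> 0 <= y -> y < p.1 ->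
  y + j%:R * p.1 < 1 - p.1 -> range_at p (n + j.+1) (y + j%:R * p.1) ->
  y < p.2 /\ range_at p n (y + 1 - p.2).
Proof.
move=> b0 ba a1 y0 ya; have Dp : bt_domain p by split; lra.
elim: j => [|j IH] yj; rewrite addnS => /range_atS[z Pz Tz].
  have /unit_itvE[z0 z1] := range_at_unit _ _ _ _ Dp Pz.
  move: Tz; rewrite mul0r addr0 addn0 /bt_map in yj Pz *.
  case: ltP => h1; [|case: ltP => h2] => Tz; try lra.
  have -> : y + 1 - p.2 = z by lra.
  by split => //; lra.
have /unit_itvE[z0 z1] := range_at_unit _ _ _ _ Dp Pz.
have ja : 0 <= j%:R * p.1 by apply: mulr_ge0; [exact: ler0n|lra].
rewrite -natr1 in yj Tz.
have e : (j%:R + 1) * p.1 = j%:R * p.1 + p.1 by ring.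
rewrite e in yj Tz.
move: Tz; rewrite /bt_map.
case: ltP => h1; [|case: ltP => h2] => Tz; try lra.
apply: IH; first lra.
by have <- : z = y + j%:R * p.1 by lra.
Qed.

Lemma attractor_level (R : realType) (p : R * R) (j : nat) (y : R) :
  0 < p.2 -> p.2 < p.1 -> p.1 < 1 -> 0 <= y -> y < p.1 ->
  y + j%:R * p.1 < 1 - p.1 ->
  attractor p (y + j%:R * p.1) <-> y < p.2 /\ attractor p (y + 1 - p.2).
Proof.
move=> b0 ba a1 y0 ya yj; have Dp : bt_domain p by split; lra.
split=> [/attractorE Px|[yb /attractorE Py]].
  have P n := range_at_level R p j n y b0 ba a1 y0 ya yj (Px (n + j.+1)%N).
  by split; [case: (P 0%N) | apply/attractorE => n; case: (P n)].
apply/attractorE => n; apply: (range_at_leq R p n (j.+1 + n)) => //.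
  exact: leq_addl.
have <- : iter j.+1 (bt_map p) (y + 1 - p.2) = y + j%:R * p.1.
  have Ty : bt_map p (y + 1 - p.2) = y.
    by rewrite /bt_map; case: ltP => ?; [|case: ltP => ?]; lra.
  rewrite iterSr Ty iter_bt_map_shift // => i ij.
  apply: le_lt_trans yj; rewrite lerD2l ler_pM2r ?ler_nat 1?ltnW //; lra.
exact: iter_range_at.
Qed.

(** Walking back at most k + 1 steps from a point of [1 - a, 1) meets the
    previous visit to that interval, which is then a preimage under the return
    map. *)
Lemma range_at_return (R : realType) (k : nat) (p : R * R) (n : nat) (x : R) :
  (0 < k)%N -> 0 < p.1 -> bt_domain (renorm k p) -> 1 - p.1 <= x -> x < 1 ->
  range_at p (n + k.+1) x ->
  exists z, [/\ 1 - p.1 <= z, z < 1, return_map k p z = x & range_at p n z].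
Proof.
move=> k0 a0 Dq x0 x1.
have [b0 ba a1 r0 ra] := renorm_domain R k p k0 a0 Dq.
have Dp := renorm_bt_domain R k p k0 a0 Dq.
have k1 : (1 : R) <= k%:R by rewrite ler1n.
rewrite addnS => /range_atS[z Pz Tz].
have /unit_itvE[z0 z1] := range_at_unit _ _ _ _ Dp Pz.
move: Tz; rewrite /bt_map.
case: ltP => h1; [|case: ltP => h2] => Tz; first last.
- exists z; split => //; last first.
    by apply: range_at_leq Pz => //; exact: leq_addr.
  (* x < b < a and x >= 1 - a leave no room for two full levels *)
  have kE : k = 1%N.
    case: (k) k0 r0 ra k1 => [//|[//|i]] _; rewrite -!natr1 => *; exfalso.
    have i0 : 0 <= i%:R * p.1 by apply: mulr_ge0; [exact: ler0n|lra].
    by lra.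
  rewrite /return_map kE mul1r in r0 ra *.
  by do 2?case: ltP => ?; lra.
- exists z; split => //; last first.
    by apply: range_at_leq Pz => //; exact: leq_addr.
  by rewrite /return_map; case: ltP => ?; lra.
have [m mlo mhi] : exists2 m, m%:R * p.1 <= z & z < m%:R * p.1 + p.1.
  have /andP[m1 m2] := truncn_itv (divr_ge0 z0 (ltW a0)).
  exists (Num.truncn (z / p.1)); first by rewrite -ler_pdivlMr.
  by move: m2; rewrite ltr_pdivrMr // -natr1; lra.
have lk (i j : nat) : (i < j)%N -> i%:R * p.1 + p.1 <= j%:R * p.1.
  move=> im; have : i.+1%:R * p.1 <= j%:R * p.1.
    by rewrite ler_pM2r // ler_nat.
  by rewrite -natr1; lra.
have mk : (m < k)%N.
  rewrite ltnNge; apply/negP => km.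
  have : k%:R * p.1 <= m%:R * p.1 by rewrite ler_pM2r // ler_nat.
  by lra.
pose y := z - m%:R * p.1.
have zE : z = y + m%:R * p.1 by rewrite /y; lra.
have [yb Py] : y < p.2 /\ range_at p (n + k - m.+1) (y + 1 - p.2).
  apply: (range_at_level R p m) => //; rewrite -?zE /y; try lra.
  by rewrite subnK // (leq_trans mk) // leq_addl.
exists (y + 1 - p.2); split; try (rewrite /y; lra); last first.
  apply: range_at_leq Py => //; rewrite -addnBA //; exact: leq_addr.
(* x = z + a is the first point of the climb that reaches [1 - a, 1) *)
have hm : (m.+1 = k) \/ (m.+2 = k).
  have km : (k <= m.+2)%N.
    rewrite leqNgt; apply/negP => /lk; rewrite -!natr1; lra.
  move: mk; rewrite leq_eqVlt => /orP[/eqP|mk]; first by left.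
  by right; apply/eqP; rewrite eqn_leq mk.
rewrite /return_map; case: ltP => h3; first lra.
case: hm => hm; rewrite -hm -!natr1 in r0 ra *; case: ltP => h4; lra.
Qed.

(** A point of [1 - a, 1) has arbitrarily long backward orbits under T exactly
    when it has arbitrarily long backward orbits under the return map, because
    each return takes between 1 and k + 1 steps. *)
Lemma attractor_return (R : realType) (k : nat) (p : R * R) (t : R) :
  (0 < k)%N -> 0 < p.1 -> bt_domain (renorm k p) -> unit_itv t ->
  attractor p (return_chart p t) <-> attractor (renorm k p) t.
Proof.
move=> k0 a0 Dq It; have Dp := renorm_bt_domain R k p k0 a0 Dq.
have chart u : unit_itv u -> 1 - p.1 <= return_chart p u /\
    return_chart p u < 1.
  move=> /unit_itvE[u0 u1]; rewrite /return_chart.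
  have h1 := mulr_ge0 (ltW a0) u0.
  have h2 : 0 < p.1 * (1 - u) by apply: mulr_gt0 => //; lra.
  by split; lra.
split=> /attractorE Px; apply/attractorE => n.
  have : range_at p (n * k.+1) (return_chart p t) by [].
  elim: n t It {Px} => [|n IH] t It; first by move=> _; exists t.
  have [x0 x1] := chart t It.
  rewrite mulSnr => /(range_at_return R k p _ _ k0 a0 Dq x0 x1)[z [z0 z1 zx Pz]].
  have [s Is sz] := return_chartP R p z a0 z0 z1.
  apply/range_atS; exists s; first by apply: IH => //; rewrite sz.
  have := zx; rewrite -sz -return_map_chart // /return_chart => /addrI.
  by move=> /(mulfI (lt0r_neq0 a0)).
have [s Is <-] := Px n.
elim: n => [|n IH] in s Is *.
  exists (return_chart p s) => //; have [? ?] := chart s Is.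
  by apply/unit_itvE; split=> //; case: Dp; lra.
rewrite iterS return_map_chart //.
have [x0 x1] := chart _ (iter_bt_map_unit _ _ n _ Dq Is).
have [m <-] := return_map_iter R k p _ k0 a0 Dq x0 x1.
apply: (range_at_leq R p _ (m.+1 + n)) => //; first by rewrite ltnS leq_addl.
by apply: iter_range_at; apply: IH.
Qed.

(** * The terminal parameters *)

Definition flip_domain {R : realType} : set (R * R) :=
  [set p | [/\ 0 < p.1, p.1 < 1, p.1 - 1 < p.2 & p.2 < 0]].

(** The interval [1 - a + b, 1) is exchanged onto itself.  A point y below it can
    only come from y - a, so n steps back require y >= n a. *)
Lemma attractor_flip (R : realType) (p : R * R) (x : R) : flip_domain p ->
  attractor p x <-> 1 - p.1 + p.2 <= x /\ x < 1.
Proof.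
move=> [a0 a1 ab b0]; have Dp : bt_domain p by split; lra.
split=> [Px|[x0 x1]]; last first.
  apply/attractorE => n; elim: n x x0 x1 => [|n IH] x x0 x1.
    by exists x => //; apply/unit_itvE; split; lra.
  apply/range_atS; have [xb|xb] := ltP x (1 + p.2).
    exists (x - p.2); first by apply: IH; lra.
    by rewrite /bt_map; case: ltP => ?; [|case: ltP => ?]; lra.
  exists (x - p.1); first by apply: IH; lra.
  by rewrite /bt_map; case: ltP => ?; [|case: ltP => ?]; lra.
have /unit_itvE[x0 x1] := attractor_unit _ _ _ Px.
split=> //; rewrite leNgt; apply/negP => xl.
have low n y : range_at p n y -> y < 1 - p.1 + p.2 -> n%:R * p.1 <= y.
  elim: n y => [|n IH] y.
    by move=> /range_at_unit-/(_ Dp)/unit_itvE[]; rewrite mul0r.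
  move=> /range_atS[z Pz]; have /unit_itvE[z0 z1] := range_at_unit _ _ _ _ Dp Pz.
  rewrite /bt_map; case: ltP => h1; [|case: ltP => h2]; move=> zy yl; try lra.
  by have := IH z Pz; rewrite -natr1; lra.
have := truncnS_gt (p.1^-1).
rewrite -(ltr_pM2r a0) mulVf ?gt_eqF //.
by have := low (Num.truncn (p.1^-1)).+1 x; move/attractorE: Px => Px /(_ (Px _) xl); lra.
Qed.

(** * Increasing bijections of the line *)

(** The inverse is carried along explicitly because every construction below is
    symmetric: the inverse is the same construction with source and target
    exchanged. *)
Definition mono_inverses {R : realType} (h g : R -> R) : Prop :=
  [/\ {homo h : x y / x <= y}, {homo g : x y / x <= y},
      cancel h g & cancel g h].

Lemma mono_inverses_lt (R : realType) (h g : R -> R) (x y : R) :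
  mono_inverses h g -> (h x < h y) = (x < y).
Proof.
move=> [hm gm hg gh]; rewrite !ltNge; congr (~~ _).
by apply/idP/idP => [/gm|/hm]; rewrite ?hg.
Qed.

Lemma mono_inverses_sym (R : realType) (h g : R -> R) :
  mono_inverses h g -> mono_inverses g h.
Proof. by case. Qed.

Lemma mono_inverses_comp (R : realType) (h g h' g' : R -> R) :
  mono_inverses h g -> mono_inverses h' g' ->
  mono_inverses (h' \o h) (g \o g').
Proof.
move=> [hm gm hg gh] [hm' gm' hg' gh']; split=> [x y xy|x y xy|x|x] /=.
- exact/hm'/hm.
- exact/gm/gm'.
- by rewrite hg' hg.
- by rewrite gh gh'.
Qed.

Definition piecewise {R : realType} (c : R) (h1 h2 : R -> R) (x : R) : R :=
  if x < c then h1 x else h2 x.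

Lemma mono_inverses_piecewise (R : realType) (c c' : R) (h1 g1 h2 g2 : R -> R) :
  mono_inverses h1 g1 -> mono_inverses h2 g2 -> h1 c = c' -> h2 c = c' ->
  mono_inverses (piecewise c h1 h2) (piecewise c' g1 g2).
Proof.
have homo_piecewise d d' k1 l1 k2 l2 : mono_inverses k1 l1 -> mono_inverses k2 l2 ->
    k1 d = d' -> k2 d = d' -> {homo piecewise d k1 k2 : x y / x <= y}.
  move=> [k1m _ _ _] [k2m _ _ _] e1 e2 x y xy; rewrite /piecewise.
  case: ltP => xc; case: ltP => yc.
  - exact: k1m.
  - by apply: le_trans (k1m _ _ (ltW xc)) _; rewrite e1 -e2; exact: k2m.
  - by have := lt_le_trans yc (le_trans xc xy); rewrite ltxx.
  - exact: k2m.
have cancel_piecewise d d' k1 l1 k2 l2 : mono_inverses k1 l1 -> mono_inverses k2 l2 ->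
    k1 d = d' -> k2 d = d' -> cancel (piecewise d k1 k2) (piecewise d' l1 l2).
  move=> m1 m2 e1 e2 x; rewrite /piecewise; case: (ltP x d) => xd.
    by rewrite -e1 (mono_inverses_lt _ _ _ _ _ m1) xd; case: m1 => _ _ ->.
  rewrite -e2 (mono_inverses_lt _ _ _ _ _ m2) ltNge xd; by case: m2 => _ _ ->.
move=> m1 m2 e1 e2; have f1 : g1 c' = c by rewrite -e1; case: m1.
have f2 : g2 c' = c by rewrite -e2; case: m2.
split; [exact: homo_piecewise m1 m2 e1 e2 | | exact: cancel_piecewise |].
  exact: homo_piecewise (mono_inverses_sym _ _ _ m1) (mono_inverses_sym _ _ _ m2) f1 f2.
exact: cancel_piecewise (mono_inverses_sym _ _ _ m1) (mono_inverses_sym _ _ _ m2) f1 f2.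
Qed.

Definition affine {R : realType} (c d c' d' : R) (x : R) : R :=
  c' + (x - c) * ((d' - c') / (d - c)).

Lemma affine_left (R : realType) (c d c' d' : R) : affine c d c' d' c = c'.
Proof. by rewrite /affine subrr mul0r addr0. Qed.

Lemma affine_right (R : realType) (c d c' d' : R) :
  c < d -> affine c d c' d' d = d'.
Proof.
move=> cd; rewrite /affine mulrC divfK ?subr_eq0 ?gt_eqF //; ring.
Qed.

Lemma mono_inverses_affine (R : realType) (c d c' d' : R) : c < d -> c' < d' ->
  mono_inverses (affine c d c' d') (affine c' d' c d).
Proof.
have homo_affine (x1 x2 y1 y2 : R) : x1 < x2 -> y1 < y2 ->
    {homo affine x1 x2 y1 y2 : x y / x <= y}.
  move=> h1 h2 x y xy; rewrite /affine lerD2l ler_wpM2r ?lerB //.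
  by rewrite divr_ge0 //; lra.
have cancel_affine (x1 x2 y1 y2 : R) : x1 < x2 -> y1 < y2 ->
    cancel (affine x1 x2 y1 y2) (affine y1 y2 x1 x2).
  move=> h1 h2 x; rewrite /affine; field.
  by rewrite !subr_eq0 !gt_eqF.
by move=> cd cd'; split; [exact: homo_affine | exact: homo_affine
  | exact: cancel_affine | exact: cancel_affine].
Qed.

(** The part of [h] on [c, c + 1] repeated with period 1: the lift of a circle
    homeomorphism fixing the integers.  It transports one level of the tower
    over [0, b) to all levels. *)
Definition circle_lift {R : realType} (c c' : R) (h : R -> R) (u : R) : R :=
  (Num.floor u)%:~R + (h (c + (u - (Num.floor u)%:~R)) - c').

Lemma frac_itv (R : realType) (u : R) :
  0 <= u - (Num.floor u)%:~R /\ u - (Num.floor u)%:~R < 1.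
Proof.
by have /andP[h1 h2] := floor_itv u; move: h2; rewrite intrD => h2; split; lra.
Qed.

Lemma floor_circle_lift (R : realType) (c c' : R) (h g : R -> R) (u : R) :
  mono_inverses h g -> h c = c' -> h (c + 1) = c' + 1 ->
  Num.floor (circle_lift c c' h u) = Num.floor u.
Proof.
move=> hgm e e1; have [u0 u1] := frac_itv _ u.
apply: floor_def; rewrite intrD /circle_lift.
have h0 : c' <= h (c + (u - (Num.floor u)%:~R)).
  by rewrite -e; case: hgm => hm _ _ _; apply: hm; lra.
have h1 : h (c + (u - (Num.floor u)%:~R)) < c' + 1.
  by rewrite -e1 (mono_inverses_lt _ _ _ _ _ hgm); lra.
by apply/andP; split; lra.
Qed.

Lemma mono_inverses_circle_lift (R : realType) (c c' : R) (h g : R -> R) :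
  mono_inverses h g -> h c = c' -> h (c + 1) = c' + 1 ->
  mono_inverses (circle_lift c c' h) (circle_lift c' c g).
Proof.
have homo_lift d d' k l : mono_inverses k l -> k d = d' -> k (d + 1) = d' + 1 ->
    {homo circle_lift d d' k : x y / x <= y}.
  move=> m e e1 x y xy.
  have : Num.floor x <= Num.floor y by exact: le_floor.
  rewrite le_eqVlt => /orP[/eqP fxy|fxy].
    rewrite /circle_lift fxy lerD2l lerD2r; case: m => km _ _ _.
    by apply: km; rewrite lerD2l lerD2r.
  have /andP[_ h1] := floor_itv (circle_lift d d' k x).
  have /andP[h2 _] := floor_itv (circle_lift d d' k y).
  rewrite !(floor_circle_lift _ _ _ _ _ _ m e e1) in h1 h2.
  apply: le_trans (ltW h1) (le_trans _ h2).
  by rewrite ler_int lezD1.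
have cancel_lift d d' k l : mono_inverses k l -> k d = d' ->
    k (d + 1) = d' + 1 -> cancel (circle_lift d d' k) (circle_lift d' d l).
  move=> m e e1 x; rewrite {1}/circle_lift (floor_circle_lift _ _ _ _ _ _ m e e1).
  have -> : d' + (circle_lift d d' k x - (Num.floor x)%:~R) =
      k (d + (x - (Num.floor x)%:~R)) by rewrite /circle_lift; ring.
  by case: m => _ _ -> _; ring.
move=> m e e1; have f : g c' = c by rewrite -e; case: m.
have f1 : g (c' + 1) = c + 1 by rewrite -e1; case: m.
have m' := mono_inverses_sym _ _ _ m.
split; [exact: homo_lift m e e1 | exact: homo_lift m' f f1
  | exact: cancel_lift | exact: cancel_lift].
Qed.

(** * Conjugacies between attractors *)

(** The node 2 - a bounds a fundamental interval [1 - a, 2 - a] for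
    [circle_lift].  Prescribing the value at 1 - b makes the levels of the tower
    break at the same place for both parameters. *)
Definition conjugacy {R : realType} (p0 p : R * R) (h g : R -> R) : Prop :=
  [/\ mono_inverses h g, h 0 = 0 /\ h 1 = 1,
      h (1 - p0.1) = 1 - p.1 /\ h (1 - p0.2) = 1 - p.2,
      h (2 - p0.1) = 2 - p.1 &
      forall x, attractor p0 x <-> attractor p (h x)].

(** In the renormalized coordinate, the level j a + [0, a) of the tower below
    1 - a is the interval [1 - a', 2 - a'), whatever j is. *)
Lemma attractor_renorm_level (R : realType) (k : nat) (p : R * R) (j : nat)
    (t : R) :
  (0 < k)%N -> 0 < p.1 -> bt_domain (renorm k p) ->
  1 - (renorm k p).1 <= t -> t < 2 - (renorm k p).1 ->
  p.1 * (t - (1 - (renorm k p).1)) + j%:R * p.1 < 1 - p.1 ->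
  attractor p (p.1 * (t - (1 - (renorm k p).1)) + j%:R * p.1) <->
  attractor (renorm k p) t.
Proof.
move=> k0 a0 Dq; have [b0 ba a1 r0 ra] := renorm_domain R k p k0 a0 Dq.
have [e1 _] := renorm_eqs R k p a0; have [q1 q2 _ _] := Dq.
move: e1 q1 q2; set a' := (renorm k p).1 => e1 q1 q2 t0 t1 xj.
have y0 : 0 <= p.1 * (t - (1 - a')) by apply: mulr_ge0; lra.
have y1 : p.1 * (t - (1 - a')) < p.1.
  have : 0 < p.1 * (2 - a' - t) by apply: mulr_gt0; lra.
  by lra.
rewrite (attractor_level R p j) //.
have -> : p.1 * (t - (1 - a')) + 1 - p.2 = return_chart p t.
  by rewrite /return_chart -e1; ring.
have [tl|tl] := ltP t 1; last first.
  have h : 0 <= p.1 * (t - 1) by apply: mulr_ge0; lra.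
  split=> [[yb _]|At]; first lra.
  by have /unit_itvE[] := attractor_unit R _ t At; lra.
have h : 0 < p.1 * (1 - t) by apply: mulr_gt0; lra.
rewrite (attractor_return R k p t) //; last by apply/unit_itvE; split; lra.
split=> [[_ At]|At]; first exact: At.
by split=> //; lra.
Qed.

(** Below 1 - p.1 the tower is transported level by level, on [1 - p.1, 1) the
    chart is used, and beyond 1 any increasing map that sends 2 - p0.1 to
    2 - p.1 will do. *)
Definition renorm_conj {R : realType} (k : nat) (p0 p : R * R) (h : R -> R) :
    R -> R :=
  piecewise (1 - p0.1)
    (affine 0 1 0 p.1
       \o circle_lift (1 - (renorm k p0).1) (1 - (renorm k p).1) h
       \o affine 0 p0.1 0 1)
    (piecewise 1 (affine 0 1 (1 - p.1) 1 \o h \o affine (1 - p0.1) 1 0 1)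
            (affine 1 (2 - p0.1) 1 (2 - p.1))).

Lemma affine_unit_to (R : realType) (c d x : R) :
  affine 0 1 c d x = c + x * (d - c).
Proof. by rewrite /affine !subr0 divr1. Qed.

Lemma affine_to_unit (R : realType) (c d x : R) :
  affine c d 0 1 x = (x - c) / (d - c).
Proof. by rewrite /affine subr0 add0r mul1r. Qed.

(** The two formulas agree at 1 - a because (1 - a) / a = (k - 1) + (a' - b'):
    the top of the last, incomplete level corresponds to the discontinuity
    1 - b' of the renormalized map, whose image is prescribed. *)
Lemma conjugacy_renorm (R : realType) (k : nat) (p0 p : R * R) (h g : R -> R) :
  (0 < k)%N -> 0 < p0.1 -> 0 < p.1 -> bt_domain (renorm k p0) ->
  bt_domain (renorm k p) -> conjugacy (renorm k p0) (renorm k p) h g ->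
  conjugacy p0 p (renorm_conj k p0 p h) (renorm_conj k p p0 g).
Proof.
move=> k0 a0 a Dq0 Dq [hg [h0 h1] [ha hb] h2a hA].
have [b00 ba0 a10 r00 ra0] := renorm_domain R k p0 k0 a0 Dq0.
have [b0 ba a1 r0 ra] := renorm_domain R k p k0 a Dq.
have [e1 e2] := renorm_eqs R k p a.
have a0n : p0.1 != 0 by rewrite gt_eqF.
have liftE : h (1 - (renorm k p0).1 + 1) = 1 - (renorm k p).1 + 1.
  have -> : 1 - (renorm k p0).1 + 1 = 2 - (renorm k p0).1 by ring.
  by rewrite h2a; ring.
have lift_mono := mono_inverses_circle_lift R _ _ h g hg ha liftE.
pose low : R -> R := affine 0 1 0 p.1
       \o circle_lift (1 - (renorm k p0).1) (1 - (renorm k p).1) h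
       \o affine 0 p0.1 0 1.
pose low' : R -> R := affine 0 1 0 p0.1
       \o circle_lift (1 - (renorm k p).1) (1 - (renorm k p0).1) g
       \o affine 0 p.1 0 1.
pose mid : R -> R := affine 0 1 (1 - p.1) 1 \o h \o affine (1 - p0.1) 1 0 1.
pose mid' : R -> R := affine 0 1 (1 - p0.1) 1 \o g \o affine (1 - p.1) 1 0 1.
have low_inv : mono_inverses low low'.
  exact: (mono_inverses_comp R _ _ _ _
    (mono_inverses_affine R 0 p0.1 0 1 a0 ltr01)
    (mono_inverses_comp R _ _ _ _ lift_mono
      (mono_inverses_affine R 0 1 0 p.1 ltr01 a))).
have mid_inv : mono_inverses mid mid'.
  have l0 : 1 - p0.1 < 1 by lra.
  have l1 : 1 - p.1 < 1 by lra.
  exact: (mono_inverses_comp R _ _ _ _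
    (mono_inverses_affine R (1 - p0.1) 1 0 1 l0 ltr01)
    (mono_inverses_comp R _ _ _ _ hg
      (mono_inverses_affine R 0 1 (1 - p.1) 1 ltr01 l1))).
have lowE x : low x = p.1 * circle_lift (1 - (renorm k p0).1)
    (1 - (renorm k p).1) h (x / p0.1).
  by rewrite /low /= affine_unit_to affine_to_unit add0r !subr0 mulrC.
have midE x : mid x = 1 - p.1 + p.1 * h ((x - 1 + p0.1) / p0.1).
  rewrite /mid /= affine_unit_to affine_to_unit; congr (_ + _).
  rewrite mulrC; congr (_ * h _); first by ring.
  by rewrite opprB addrA; congr (_ / _); ring.
have low_end : low (1 - p0.1) = 1 - p.1.
  have kE : (k.-1%:R : R) = k%:R - 1 by rewrite -{2}(prednK k0) -natr1; ring.
  have fE : Num.floor ((1 - p0.1) / p0.1) = k.-1%:Z.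
    apply: floor_def; rewrite intrD -!pmulrn kE ler_pdivlMr // ltr_pdivrMr //.
    by apply/andP; split; lra.
  rewrite lowE /circle_lift fE -pmulrn kE.
  have -> : 1 - (renorm k p0).1 + ((1 - p0.1) / p0.1 - (k%:R - 1)) =
      1 - (renorm k p0).2.
    by rewrite /renorm /=; field.
  by rewrite hb; lra.
have mid_start : mid (1 - p0.1) = 1 - p.1.
  have -> : mid (1 - p0.1) = 1 - p.1 + p.1 * h 0.
    by rewrite midE; congr (_ + _ * h _); field.
  by rewrite h0; ring.
have mid1 : mid 1 = 1.
  by rewrite midE subrr add0r divff // h1; ring.
have l1 : 1 < 2 - p0.1 by lra.
have l1' : 1 < 2 - p.1 by lra.
have up_inv := mono_inverses_piecewise R 1 1 _ _ _ _ mid_inv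
  (mono_inverses_affine R 1 (2 - p0.1) 1 (2 - p.1) l1 l1') mid1
  (affine_left _ _ _ _ _).
have up_start : piecewise 1 mid (affine 1 (2 - p0.1) 1 (2 - p.1)) (1 - p0.1) = 1 - p.1.
  by rewrite /piecewise ifT // ; lra.
have H_inv := mono_inverses_piecewise R _ _ _ _ _ _ low_inv up_inv low_end up_start.
have H_low x : x < 1 - p0.1 -> renorm_conj k p0 p h x = low x.
  by move=> xl; rewrite /renorm_conj /piecewise xl.
have H_mid x : 1 - p0.1 <= x -> x < 1 -> renorm_conj k p0 p h x = mid x.
  by move=> xl x1; rewrite /renorm_conj /piecewise ltNge xl /= x1.
have H_up x : 1 <= x -> renorm_conj k p0 p h x =
    affine 1 (2 - p0.1) 1 (2 - p.1) x.
  move=> xl; rewrite /renorm_conj /piecewise !ifF //; first by rewrite ltNge xl.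
  by apply/negbTE; rewrite -leNgt; lra.
have low0 : low 0 = 0.
  rewrite lowE mul0r /circle_lift floor0 subr0 addr0 ha; ring.
have H1 : renorm_conj k p0 p h 1 = 1 by rewrite H_up // affine_left.
have Ha : renorm_conj k p0 p h (1 - p0.1) = 1 - p.1 by rewrite H_mid //; lra.
have H0 : renorm_conj k p0 p h 0 = 0 by rewrite H_low //; lra.
split => //.
- split => //; rewrite H_mid; [|lra|lra].
  have -> : mid (1 - p0.2) = 1 - p.1 + p.1 * h (1 - (renorm k p0).1).
    by rewrite midE; congr (_ + _ * h _); rewrite /renorm /=; field.
  by rewrite ha mulrBr e1; ring.
- by rewrite H_up ?affine_right //; lra.
move=> x; have H_lt := mono_inverses_lt R _ _ _ _ H_inv.
have [x0|x0] := ltP x 0.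
  split=> /attractor_unit/unit_itvE[]; first lra.
  by rewrite -[leLHS]H0 leNgt H_lt x0.
have [x1|x1] := ltP x 1; last first.
  split=> /attractor_unit/unit_itvE[_]; first lra.
  by rewrite -[ltRHS]H1 H_lt ltNge x1.
have [xa|xa] := leP (1 - p0.1) x.
  have [t It tx] := return_chartP R p0 x a0 xa x1.
  have -> : renorm_conj k p0 p h x = return_chart p (h t).
    rewrite H_mid // midE -tx /return_chart; congr (_ + _ * h _); field => //.
  rewrite -tx (attractor_return R k p0 t) // (attractor_return R k p) //.
  move: It => /unit_itvE[t0 t1]; apply/unit_itvE; split.
    by rewrite -h0; case: hg => hm _ _ _; apply: hm.
  by rewrite -h1 (mono_inverses_lt R _ _ _ _ hg).
have Hxa : renorm_conj k p0 p h x < 1 - p.1 by rewrite -Ha H_lt.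
have [u0 u1] := frac_itv R (x / p0.1).
have j0 : 0 <= Num.floor (x / p0.1) by rewrite floor_ge0 divr_ge0 // ltW.
move: Hxa; rewrite H_low // lowE /circle_lift.
move: u0 u1; set j := `|Num.floor (x / p0.1)|%N.
have -> : (Num.floor (x / p0.1))%:~R = j%:R :> R.
  by rewrite pmulrn /j gez0_abs.
set t := 1 - (renorm k p0).1 + (x / p0.1 - j%:R) => u0 u1.
have xE : x = p0.1 * (t - (1 - (renorm k p0).1)) + j%:R * p0.1.
  by rewrite /t; field.
have -> : p.1 * (j%:R + (h t - (1 - (renorm k p).1))) =
  p.1 * (h t - (1 - (renorm k p).1)) + j%:R * p.1 by ring.
move=> Hxa; rewrite (attractor_renorm_level R k p) //; last first.
- by rewrite -h2a (mono_inverses_lt R _ _ _ _ hg) /t; lra.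
- by rewrite -ha; case: hg => hm _ _ _; apply: hm; rewrite /t; lra.
rewrite {1}xE (attractor_renorm_level R k p0) //; rewrite -?xE // /t; lra.
Qed.

(** * Families of conjugacies depending continuously on the parameter *)

Fixpoint polyline {R : realType} (u : R * R) (s : seq (R * R)) : R -> R :=
  if s is v :: s' then piecewise v.1 (affine u.1 v.1 u.2 v.2) (polyline v s')
  else affine u.1 (u.1 + 1) u.2 (u.2 + 1).

Definition node_lt {R : realType} : rel (R * R) :=
  fun u v => (u.1 < v.1) && (u.2 < v.2).

Lemma polyline_head (R : realType) (u : R * R) (s : seq (R * R)) :
  path node_lt u s -> polyline u s u.1 = u.2.
Proof.
case: s => [|v s] /=; first by rewrite affine_left.
by move=> /andP[/andP[uv _] _]; rewrite /piecewise uv affine_left.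
Qed.

Lemma mono_inverses_polyline (R : realType) (u : R * R) (s : seq (R * R)) :
  path node_lt u s ->
  mono_inverses (polyline u s)
    (polyline (u.2, u.1) [seq (v.2, v.1) | v <- s]).
Proof.
elim: s u => [|v s IH] u /=.
  by move=> _; apply: mono_inverses_affine; rewrite ltrDl.
move=> /andP[/andP[uv1 uv2] vs]; apply: mono_inverses_piecewise.
- exact: mono_inverses_affine.
- exact: IH.
- exact: affine_right.
- exact: polyline_head.
Qed.

Lemma polyline_node (R : realType) (u v : R * R) (s : seq (R * R)) :
  path node_lt u s -> v \in s -> polyline u s v.1 = v.2.
Proof.
elim: s u => [//|w s IH] u /= /andP[_ ws].
rewrite inE => /orP[/eqP->|vs].
  by rewrite /piecewise ltxx polyline_head.
rewrite /piecewise ifF; first exact: IH.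
apply/negbTE; rewrite -leNgt.
have tr : transitive (@node_lt R).
  move=> y x z /andP[xy1 xy2] /andP[yz1 yz2].
  by rewrite /node_lt (lt_trans xy1) // (lt_trans xy2).
by move: (allP (order_path_min tr ws) _ vs) => /andP[/ltW].
Qed.

Lemma cvg_affine (R : realType) (c d x : R) (f g : R * R -> R) (p0 : R * R) :
  c != d -> f p @[p --> p0] --> c -> g p @[p --> p0] --> d ->
  affine c d (f p) (g p) x @[p --> p0] --> x.
Proof.
move=> cd fc gd; rewrite /affine.
rewrite [X in _ --> X](_ : x = c + (x - c) * ((d - c) / (d - c))); last first.
  by rewrite divff ?mulr1 ?subr_eq0 1?eq_sym //; ring.
apply: cvgD => //; apply: cvgM; first exact: cvg_cst.
by apply: cvgM; [exact: cvgB | exact: cvg_cst].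
Qed.

Lemma cvg_polyline (R : realType) (c x : R) (f : R * R -> R)
    (s : seq (R * (R * R -> R))) (p0 : R * R) :
  path <%R c [seq e.1 | e <- s] -> f p @[p --> p0] --> c ->
  (forall i, (i < size s)%N ->
     (nth (c, f) s i).2 p @[p --> p0] --> (nth (c, f) s i).1) ->
  polyline (c, f p) [seq (e.1, e.2 p) | e <- s] x @[p --> p0] --> x.
Proof.
elim: s c f => [|[d g] s IH] c f /=.
  move=> _ fc _; apply: cvg_affine => //; first by rewrite lt_eqF // ltrDl.
  by apply: cvgD => //; exact: cvg_cst.
move=> /andP[cd ds] fc hs; have gd := hs 0%N isT; rewrite /piecewise /=.
case: (ltP x d) => _; first by apply: cvg_affine => //; rewrite lt_eqF.
apply: IH => // i si; have := hs i.+1 si; rewrite /=.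
by rewrite (set_nth_default (d, g)).
Qed.

(** Convergence to the identity is asked pointwise only: for increasing maps it
    is automatically uniform on compact intervals (see [near_uniform]), and the
    pointwise form passes through [renorm_conj] by continuity of each formula at
    a fixed point. *)
Definition conj_family {R : realType} (U : set (R * R)) : Prop :=
  forall p0, U p0 -> exists h g : R * R -> R -> R,
    (forall p, U p -> conjugacy p0 p (h p) (g p)) /\
    (forall x, h p x @[p --> p0] --> x).

Lemma conj_family_flip (R : realType) : conj_family (@flip_domain R).
Proof.
move=> p0 U0; have [a0 a01 ab0 b0] := U0.
pose s (p : R * R) := [:: (1 - p0.1 + p0.2, 1 - p.1 + p.2);
   (1 - p0.1, 1 - p.1); (1, 1); (1 - p0.2, 1 - p.2); (2 - p0.1, 2 - p.1)].
pose h p := polyline (0, 0) (s p).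
pose g p := polyline (0, 0) [seq (v.2, v.1) | v <- s p].
exists h, g; split.
  move=> p Up; have [a a1 ab b] := Up.
  have ss : path node_lt (0, 0) (s p).
    by rewrite /= /node_lt /=; do !(apply/andP; split => //); lra.
  have hg : mono_inverses (h p) (g p) := mono_inverses_polyline _ _ _ ss.
  have hE x y : (x, y) \in s p -> h p x = y by exact: (polyline_node _ _ (x, y)).
  have hb : h p (1 - p0.1 + p0.2) = 1 - p.1 + p.2.
    by apply: hE; rewrite !inE eqxx ?orbT.
  have h1 : h p 1 = 1 by apply: hE; rewrite !inE eqxx ?orbT.
  split => //.
  - by split => //; exact: (polyline_head _ (0, 0)).
  - by split; apply: hE; rewrite !inE eqxx ?orbT.
  - by apply: hE; rewrite !inE eqxx ?orbT.
  - move=> x; rewrite !attractor_flip // !leNgt.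
    have := mono_inverses_lt _ _ _ x 1 hg; rewrite h1 => ->.
    by have := mono_inverses_lt _ _ _ x (1 - p0.1 + p0.2) hg; rewrite hb => ->.
have c1 : p.1 @[p --> p0] --> p0.1 by exact: cvg_fst.
have c2 : p.2 @[p --> p0] --> p0.2 by exact: cvg_snd.
have cc (c : R) : (fun=> c) @ p0 --> c by exact: cvg_cst.
move=> x.
apply: (cvg_polyline _ 0 x (fun=> 0)
  [:: (1 - p0.1 + p0.2, (fun p => 1 - p.1 + p.2) : R * R -> R);
   (1 - p0.1, fun p => 1 - p.1); (1, fun=> 1); (1 - p0.2, fun p => 1 - p.2);
   (2 - p0.1, fun p => 2 - p.1)]) => //=.
  by do !(apply/andP; split => //); lra.
by case=> [|[|[|[|[|//]]]]] _ /=; [apply: cvgD => //; apply: cvgB | apply: cvgB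
  | | apply: cvgB | apply: cvgB].
Qed.

Definition renorm_preimage {R : realType} (k : nat) (U : set (R * R)) :
    set (R * R) := [set p | 0 < p.1 /\ U (renorm k p)].

Lemma cvg_renorm (R : realType) (k : nat) (p0 : R * R) : 0 < p0.1 ->
  renorm k p @[p --> p0] --> renorm k p0.
Proof.
move=> a0; have c1 : p.1 @[p --> p0] --> p0.1 by exact: cvg_fst.
have c2 : p.2 @[p --> p0] --> p0.2 by exact: cvg_snd.
have cV : p.1^-1 @[p --> p0] --> p0.1^-1 by apply: cvgV => //; rewrite gt_eqF.
have d1 : p.2 / p.1 @[p --> p0] --> p0.2 / p0.1 by exact: cvgM.
have d2 : (p.2 - 1) / p.1 + k%:R @[p --> p0] --> (p0.2 - 1) / p0.1 + k%:R.
  apply: cvgD; last exact: cvg_cst.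
  by apply: cvgM => //; apply: cvgB => //; exact: cvg_cst.
exact: (cvg_pair d1 d2).
Qed.

Lemma open_renorm_preimage (R : realType) (k : nat) (U : set (R * R)) :
  open U -> open (renorm_preimage k U).
Proof.
rewrite !openE => oU p [a0 Up].
apply: (@filterI _ (nbhs p) _ [set q | 0 < q.1] (renorm k @^-1` U)).
  have c1 : q.1 @[q --> p] --> p.1 by exact: cvg_fst.
  by apply: (c1 [set x | 0 < x]); exact: lt_nbhsr.
by apply: (cvg_renorm R k p a0 U); exact: oU.
Qed.

Lemma cvg_circle_lift (R : realType) (c x : R) (f : R * R -> R)
    (h : R * R -> R -> R) (p0 : R * R) :
  f p @[p --> p0] --> c -> (forall y, h p y @[p --> p0] --> y) ->
  circle_lift c (f p) (h p) x @[p --> p0] --> x.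
Proof.
move=> fc hc; rewrite /circle_lift.
rewrite [X in _ --> X](_ : x =
  (Num.floor x)%:~R + (c + (x - (Num.floor x)%:~R) - c)); last by ring.
by apply: cvgD; [exact: cvg_cst | apply: cvgB].
Qed.

Lemma conj_family_renorm (R : realType) (k : nat) (U : set (R * R)) :
  (0 < k)%N -> U `<=` bt_domain -> conj_family U ->
  conj_family (renorm_preimage k U).
Proof.
move=> k0 UD cU p0 [a0 Up0]; have [h [g [hg hc]]] := cU _ Up0.
exists (fun p => renorm_conj k p0 p (h (renorm k p))).
exists (fun p => renorm_conj k p p0 (g (renorm k p))); split.
  move=> p [a Up]; apply: conjugacy_renorm => //; [exact: UD | exact: UD |].
  exact: hg.
have [b0 ba a1 _ _] := renorm_domain R k p0 k0 a0 (UD _ Up0).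
have c1 : p.1 @[p --> p0] --> p0.1 by exact: cvg_fst.
have cR := cvg_renorm R k p0 a0.
have hR y : h (renorm k p) y @[p --> p0] --> y.
  exact: (cvg_comp _ _ cR (hc y)).
have cA : (renorm k p).1 @[p --> p0] --> (renorm k p0).1.
  exact: (cvg_comp _ _ cR cvg_fst).
have cc (c : R) : (fun=> c) @ p0 --> c by exact: cvg_cst.
move=> x; rewrite /renorm_conj /piecewise; case: (ltP x (1 - p0.1)) => [_|_].
  have cA1 : 1 - (renorm k p).1 @[p --> p0] --> 1 - (renorm k p0).1.
    exact: cvgB (cc 1) cA.
  have cL := cvg_circle_lift R (1 - (renorm k p0).1) (affine 0 p0.1 0 1 x)
    (fun p => 1 - (renorm k p).1) (fun p => h (renorm k p)) p0
    cA1 hR.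
  rewrite [X in _ --> X](_ : x = 0 + affine 0 p0.1 0 1 x * p0.1); last first.
    by rewrite affine_to_unit !subr0 add0r divfK // gt_eqF.
  under eq_cvg => p do rewrite /= affine_unit_to subr0.
  by apply: cvgD; [exact: cc | exact: cvgM cL c1].
case: (ltP x 1) => [_|_].
  rewrite [X in _ --> X](_ : x =
      1 - p0.1 + affine (1 - p0.1) 1 0 1 x * (1 - (1 - p0.1))); last first.
    rewrite affine_to_unit divfK; first by ring.
    by rewrite opprB addrCA subrr addr0 gt_eqF.
  under eq_cvg => p do rewrite /= affine_unit_to.
  have c1a : 1 - p.1 @[p --> p0] --> 1 - p0.1 by exact: cvgB (cc 1) c1.
  exact: cvgD c1a (cvgM (hR _) (cvgB (cc 1) c1a)).
apply: cvg_affine; [|exact: cc|exact: cvgB (cc 2) c1].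
by rewrite lt_eqF //; lra.
Qed.

(** The open sets of parameters whose renormalizations follow a common sequence
    of values of k and then end in [flip_domain]. *)
Inductive renormalizable {R : realType} : set (R * R) -> Prop :=
| renormalizable_flip : renormalizable flip_domain
| renormalizable_preimage k U : (0 < k)%N -> renormalizable U ->
    renormalizable (renorm_preimage k U).

Lemma renormalizable_spec (R : realType) (U : set (R * R)) :
  renormalizable U -> [/\ open U, U `<=` bt_domain & conj_family U].
Proof.
elim=> [|k {}U k0 _ [oU UD cU]].
  split; [| |exact: conj_family_flip].
    rewrite openE => p [h1 h2 h3 h4].
    have c1 : q.1 @[q --> p] --> p.1 by exact: cvg_fst.
    have c2 : q.2 @[q --> p] --> p.2 by exact: cvg_snd.
    have c12 : q.2 - q.1 @[q --> p] --> p.2 - p.1 by exact: cvgB.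
    have h3' : -1 < p.2 - p.1 by lra.
    near=> q; split.
    - by near: q; apply: (c1 [set x | 0 < x]); exact: lt_nbhsr.
    - by near: q; apply: (c1 [set x | x < 1]); exact: lt_nbhsl.
    - suff : -1 < q.2 - q.1 by lra.
      by near: q; apply: (c12 [set x | -1 < x]); exact: lt_nbhsr.
    - by near: q; apply: (c2 [set x | x < 0]); exact: lt_nbhsl.
  by move=> p [h1 h2 h3 h4]; split; lra.
split; [exact: open_renorm_preimage | | exact: conj_family_renorm].
by move=> p [a0 /UD]; exact: renorm_bt_domain.
Unshelve. all: by end_near.
Qed.

(** * Stability *)

Lemma bt_map_cts (R : realType) (p : R * R) (x : R) :
  p.2 < p.1 -> x != 1 - p.1 -> x != 1 - p.2 ->
  bt_map p y @[y --> within unit_itv (nbhs x)] --> bt_map p x.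
Proof.
move=> ba xa xb.
suff H : bt_map p y @[y --> x] --> bt_map p x.
  exact: cvg_trans (cvg_app (bt_map p) (@cvg_within _ (nbhs x) _ unit_itv)) H.
have shift (c d : R) : y + c + d @[y --> x] --> x + c + d.
  by apply: cvgD; [apply: cvgD; [exact: cvg_id | exact: cvg_cst] | exact: cvg_cst].
have local c d : (\forall y \near x, bt_map p y = y + c + d) ->
    bt_map p y @[y --> x] --> bt_map p x.
  move=> E; rewrite (nbhs_singleton E).
  by apply: cvg_trans (shift c d); apply: near_eq_cvg; apply: filterS E => y ->.
have [xa'|xa'] := ltP x (1 - p.1).
  apply: (local p.1 0); near=> y; rewrite addr0 /bt_map ifT //.
  by near: y; exact: lt_nbhsl.
have xa2 : 1 - p.1 < x by rewrite lt_neqAle eq_sym xa.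
have [xb'|xb'] := ltP x (1 - p.2).
  apply: (local p.2 0); near=> y; rewrite addr0 /bt_map ifF ?ifT //.
    by near: y; exact: lt_nbhsl.
  apply/negbTE; rewrite -leNgt ltW //; near: y; exact: lt_nbhsr.
have xb2 : 1 - p.2 < x by rewrite lt_neqAle eq_sym xb.
apply: (local p.2 (-1)); near=> y; rewrite /bt_map !ifF //.
  apply/negbTE; rewrite -leNgt ltW //; near: y; exact: lt_nbhsr.
apply/negbTE; rewrite -leNgt ltW //; near: y; exact: lt_nbhsr.
Unshelve. all: by end_near.
Qed.

(** Both discontinuities are seen from the left, where the map tends to 1; this
    criterion covers them together. *)
Lemma left_jump (R : realType) (f : R -> R) (x m0 e : R) :
  0 < m0 -> 0 < e ->
  (forall m, 0 < m -> m <= m0 -> unit_itv (x - m) /\ e <= `|f x - f (x - m)|) ->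
  ~ (f y @[y --> within unit_itv (nbhs x)] --> f x).
Proof.
move=> m00 e0 jump /cvgrPdist_lt/(_ e e0).
rewrite near_withinE => /nbhs_ballP[d /= d0 xd].
pose m := Num.min m0 (d / 2).
have m_gt0 : 0 < m by rewrite lt_min m00 divr_gt0.
have [Iy ey] : unit_itv (x - m) /\ e <= `|f x - f (x - m)|.
  by apply: jump => //; rewrite ge_min lexx.
have : ball x d (x - m).
  rewrite /ball /= opprB addrCA subrr addr0 gtr0_norm //.
  by rewrite gt_min [X in _ || X]ltr_pdivrMr // ltr_pMr // ltr1n orbT.
by move=> /xd/(_ Iy); rewrite ltNge ey.
Qed.

Lemma discontinuitiesE (R : realType) (p : R * R) :
  0 < p.2 -> p.2 < p.1 -> p.1 < 1 ->
  discontinuities p = [set 1 - p.1; 1 - p.2].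
Proof.
move=> b0 ba a1; apply/seteqP; split=> x /=.
  move=> [_ nx]; apply: contrapT => /not_orP[/eqP xa /eqP xb].
  by apply: nx; exact: bt_map_cts.
case=> ->; split; try (by apply/unit_itvE; split; lra).
  apply: (left_jump R _ _ (Num.min ((p.1 - p.2) / 2) (1 - p.1))
    ((p.1 - p.2) / 2)).
  - by rewrite lt_min; apply/andP; split; lra.
  - lra.
  move=> m m0; rewrite le_min => /andP[m1 m2]; split.
    by apply/unit_itvE; split; lra.
  rewrite /bt_map ltxx ifT; last lra.
  rewrite ifT; last lra.
  by rewrite ler0_norm; lra.
apply: (left_jump R _ _ (Num.min (1 / 2) (p.1 - p.2)) (1 / 2)).
- by rewrite lt_min; apply/andP; split; lra.
- lra.
move=> m m0; rewrite le_min => /andP[m1 m2]; split.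
  by apply/unit_itvE; split; lra.
rewrite /bt_map ltxx ifF; last by apply/negbTE; rewrite -leNgt; lra.
rewrite ifF; last by apply/negbTE; rewrite -leNgt; lra.
rewrite ifT; last lra.
by rewrite ler0_norm; lra.
Qed.

(** The preimage of an open interval around h x is the open interval between the
    g-images of its ends. *)
Lemma mono_inverses_continuous (R : realType) (h g : R -> R) :
  mono_inverses h g -> continuous h.
Proof.
move=> m x; apply/cvgrPdist_lt => e e0.
have m' := mono_inverses_sym _ _ _ m; have [_ _ hg gh] := m.
have l : g (h x - e) < x.
  by rewrite -{2}(hg x) (mono_inverses_lt _ _ _ _ _ m'); lra.
have u : x < g (h x + e).
  by rewrite -{1}(hg x) (mono_inverses_lt _ _ _ _ _ m'); lra.
near=> y; rewrite ltr_distlC; apply/andP; split.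
  rewrite -{1}(gh (h x - e)) (mono_inverses_lt _ _ _ _ _ m).
  by near: y; exact: lt_nbhsr.
rewrite -{1}(gh (h x + e)) (mono_inverses_lt _ _ _ _ _ m).
by near: y; exact: lt_nbhsl.
Unshelve. all: by end_near.
Qed.

Lemma closure_continuous (S T : topologicalType) (f : S -> T) (A : set S)
    (B : set T) (x : S) :
  continuous f -> (forall x, A x -> B (f x)) -> closure A x -> closure B (f x).
Proof.
move=> fc AB Ax W /fc Wx; have [y [Ay Wy]] := Ax _ Wx.
by exists (f y); split => //; exact: AB.
Qed.

Lemma conjugacy_closure (R : realType) (p0 p : R * R) (h g : R -> R) (x : R) :
  conjugacy p0 p h g ->
  closure (attractor p0) x <-> closure (attractor p) (h x).
Proof.
move=> [m _ _ _ hA]; have [_ _ hg gh] := m.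
have hc : continuous h := mono_inverses_continuous R h g m.
have gc : continuous g.
  exact: mono_inverses_continuous (mono_inverses_sym _ _ _ m).
have gA y : attractor p y -> attractor p0 (g y) by rewrite -{1}(gh y) => /hA.
split=> [|Bx]; first exact: (closure_continuous R R h _ _ x hc (fun y => (hA y).1)).
rewrite -(hg x); exact: (closure_continuous R R g _ _ _ gc gA).
Qed.

(** Closeness on a finite grid of mesh less than e / 2 controls a monotone map
    between consecutive grid points. *)
Lemma near_uniform (R : realType) (h : R * R -> R -> R) (p0 : R * R) (e : R) :
  (\forall p \near p0, {homo h p : x y / x <= y}) ->
  (forall x, h p x @[p --> p0] --> x) -> 0 < e ->
  \forall p \near p0, forall x, 0 <= x <= 1 -> `|h p x - x| < e.
Proof.
move=> hm hc e0; pose N : R := (Num.truncn (2 / e)).+1%:R.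
have N0 : 0 < N by rewrite ltr0n.
have Ne : N^-1 < e / 2.
  rewrite -[e / 2]invrK ltf_pV2 ?posrE ?invr_gt0 ?divr_gt0 //.
  by rewrite invf_div truncnS_gt.
have grid : \forall p \near p0, forall i : 'I_(Num.truncn (2 / e)).+3,
    `|i%:R / N - h p (i%:R / N)| < e / 2.
  apply: (@filter_forall _ _ (fun (i : 'I_(Num.truncn (2 / e)).+3) =>
    [set p | `|i%:R / N - h p (i%:R / N)| < e / 2]) (nbhs p0)) => i.
  move: (hc (i%:R / N)) => /cvgrPdist_lt; apply.
  by rewrite divr_gt0.
near=> p => x /andP[x0 x1].
have mp : {homo h p : x y / x <= y} by near: p.
have gp : forall i : 'I_(Num.truncn (2 / e)).+3,
    `|i%:R / N - h p (i%:R / N)| < e / 2 by near: p.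
have xN : 0 <= x * N by rewrite mulr_ge0 // ltW.
have /andP[i0 i1] := truncn_itv xN.
set i := Num.truncn (x * N) in i0 i1.
have iN : (i < (Num.truncn (2 / e)).+2)%N.
  rewrite ltnS -(ler_nat R); apply: le_trans i0 _.
  by rewrite ler_piMl // ltW.
have lo : h p (i%:R / N) <= h p x by apply: mp; rewrite ler_pdivrMr.
have hi : h p x <= h p (i.+1%:R / N) by apply: mp; rewrite ler_pdivlMr // ltW.
have := gp (Ordinal (ltnW iN : (i < (Num.truncn (2 / e)).+3)%N)).
have := gp (Ordinal (iN : (i.+1 < (Num.truncn (2 / e)).+3)%N)).
rewrite /= !ltr_distlC => /andP[_ b1] /andP[b2 _].
have c1 : x < i%:R / N + N^-1.
  by rewrite -[X in _ + X]mul1r -mulrDl ltr_pdivlMr // natr1.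
have c2 : i%:R / N <= x by rewrite ler_pdivrMr.
have c3 : i.+1%:R / N = i%:R / N + N^-1 by rewrite -natr1 mulrDl mul1r.
rewrite {}c3 in hi b1.
move: N^-1 (i%:R / N) Ne lo hi b1 b2 c1 c2 => v u Ne lo hi b1 b2 c1 c2.
by apply/andP; split; lra.
Unshelve. all: by end_near.
Qed.

Lemma closure_attractor_itv (R : realType) (p : R * R) (x : R) :
  closure (attractor p) x -> 0 <= x <= 1.
Proof.
have cl : closed `[(0 : R), 1] by exact: itv_closed.
move=> /(closure_subset (B := `[(0 : R), 1])) H.
have : closure `[(0 : R), 1] x.
  by apply: H => y /attractor_unit/unit_itvE[y0 y1]; rewrite /= in_itv /= y0 ltW.
by move/cl; rewrite /= in_itv.
Qed.

(** All clauses of stability come from the ambient homeomorphisms.  They are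
    uniformly close to the identity on [0, 1] for nearby parameters, which gives
    Hausdorff continuity.  They match closed attractors and discontinuities,
    which gives the homeomorphism type and the number of discontinuities in the
    gaps. *)
Lemma stable_renormalizable (R : realType) (U : set (R * R)) :
  renormalizable U ->
  (forall p, U p -> [/\ 0 < p.2, p.2 < p.1 & p.1 < 1]) ->
  forall p, U p -> stable p.
Proof.
move=> rU Uint p Up; have [oU _ cU] := renormalizable_spec _ _ rU.
have [h [g [hg hc]]] := cU _ Up.
have gapE q : U q -> discontinuities q `&` (unit_itv `\` closure (attractor q))
    = [set 1 - q.1; 1 - q.2] `\` closure (attractor q).
  move=> Uq; have [b0 ba a1] := Uint _ Uq; rewrite discontinuitiesE //.
  apply/seteqP; split=> x [] h1; first by case.
  move=> h2; split => //; split => //; apply/unit_itvE.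
  by case: h1 => ->; split; lra.
exists U; split.
- by move=> q /Uint[b0 ba a1]; rewrite /triangle /=; split; [|split]; lra.
- by move: oU; rewrite openE => oU; apply: filterS (oU _ Up) => q Uq _.
- move=> q Uq e e0; have [k [l [kl kc]]] := cU _ Uq.
  have Unear : nbhs q U by move: oU; rewrite openE => oU; exact: oU.
  have kmono : \forall r \near q, {homo k r : x y / x <= y}.
    by apply: filterS Unear => r /kl[[]].
  rewrite near_withinE; apply: filterS (near_uniform R k q e kmono kc e0).
  move=> r close Ur; have C := kl _ Ur; have [[_ _ _ lk] _ _ _ _] := C.
  split=> x Ax.
    exists (k r x); first by rewrite /= -(conjugacy_closure R q r _ _ _ C).
    rewrite -ball_normE /=; apply: close; exact: closure_attractor_itv Ax.
  have Al : closure (attractor q) (l r x).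
    by apply/(conjugacy_closure R q r _ _ _ C); rewrite lk.
  exists (l r x) => //; rewrite -ball_normE /= distrC -{1}(lk x).
  by apply: close; exact: closure_attractor_itv Al.
- move=> q Uq; have C := hg _ Uq; have [m _ _ _ _] := C.
  have [_ _ gh' hg'] := m.
  exists (g q), (h q); split; last split.
  + split=> // [_ [x Ax <-]|_ [x Ax <-]].
      by apply/(conjugacy_closure R p q _ _ _ C); rewrite hg'.
    by apply/(conjugacy_closure R p q _ _ _ C).
  + apply: continuous_subspaceT.
    exact: mono_inverses_continuous (mono_inverses_sym _ _ _ m).
  + by apply: continuous_subspaceT; exact: mono_inverses_continuous m.
have [n cn] : finite_set ([set 1 - p.1; 1 - p.2] `\` closure (attractor p)).
  exact: finite_setD (finite_set2 _ _).
exists n => q Uq; rewrite gapE //; apply: card_eq_trans cn.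
have C := hg _ Uq; have [m _ [ha hb] _ _] := C.
have -> : [set 1 - q.1; 1 - q.2] `\` closure (attractor q) =
    h q @` ([set 1 - p.1; 1 - p.2] `\` closure (attractor p)).
  apply/seteqP; split=> [x [/= xE Ax]|_ [x [/= xE Ax] <-]]; last first.
    split; last by move/(conjugacy_closure R p q _ _ _ C).
    by case: xE => ->; [left; rewrite ha | right; rewrite hb].
  case: xE Ax => ->; rewrite -?ha -?hb => Ax.
    exists (1 - p.1) => //; split; first by left.
    by move/(conjugacy_closure R p q _ _ _ C).
  exists (1 - p.2) => //; split; first by right.
  by move/(conjugacy_closure R p q _ _ _ C).
have [_ _ /can_inj hinj _] := m.
by apply: inj_card_eq => x y _ _; exact: hinj.
Qed.

(** * Density *)

Definition eventually_flip {R : realType} : set (R * R) :=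
  [set p | exists2 U, renormalizable U & U p].

(** At least one renormalization step forces 0 < b < a < 1, which
    [flip_domain] itself violates. *)
Definition eventually_flip_pos {R : realType} : set (R * R) :=
  [set p | exists k U, [/\ (0 < k)%N, renormalizable U & renorm_preimage k U p]].

Lemma eventually_flip_pos_stable (R : realType) (p : R * R) :
  eventually_flip_pos p -> triangle p /\ stable p.
Proof.
move=> [k [U [k0 rU Vp]]].
have VI q : renorm_preimage k U q -> [/\ 0 < q.2, q.2 < q.1 & q.1 < 1].
  move=> [a0 Uq]; have [_ UD _] := renormalizable_spec _ _ rU.
  by have [? ? ? _ _] := renorm_domain R k q k0 a0 (UD _ Uq).
split; first by have [b0 ba a1] := VI _ Vp; split; [|split]; lra.
exact: stable_renormalizable (renormalizable_preimage _ _ k0 rU) VI _ Vp.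
Qed.

Lemma eventually_flip_posW (R : realType) :
  @eventually_flip_pos R `<=` eventually_flip.
Proof.
move=> p [k [U [k0 rU Vp]]]; exists (renorm_preimage k U) => //.
exact: renormalizable_preimage.
Qed.

(** The homogeneous step (x, y, z) |-> (y, z, z - x + k y) solved for x, y and z
    in terms of its image. *)
Definition unrenorm {R : realType} (k : nat) (q : R * R) : R * R :=
  (1 / (k%:R + q.1 - q.2), q.1 / (k%:R + q.1 - q.2)).

Lemma eventually_flip_pos_unrenorm (R : realType) (k : nat) (q : R * R) :
  (0 < k)%N -> 0 < k%:R + q.1 - q.2 -> eventually_flip q ->
  eventually_flip_pos (unrenorm k q).
Proof.
move=> k0 d0 [U rU Uq]; exists k, U; split => //; split.
  by rewrite /unrenorm /= divr_gt0.
suff -> : renorm k (unrenorm k q) = q by [].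
case: q d0 {Uq} => a b /= d0; rewrite /renorm /unrenorm /=.
by congr (_, _); field; rewrite gt_eqF.
Qed.

Lemma closure_unrenorm (R : realType) (k : nat) (q : R * R) :
  (0 < k)%N -> 0 < k%:R + q.1 - q.2 -> closure eventually_flip q ->
  closure eventually_flip_pos (unrenorm k q).
Proof.
move=> k0 d0 clq W Wq.
have c1 : p.1 @[p --> q] --> q.1 by exact: cvg_fst.
have c2 : p.2 @[p --> q] --> q.2 by exact: cvg_snd.
have cd : k%:R + p.1 - p.2 @[p --> q] --> k%:R + q.1 - q.2.
  by apply: cvgB => //; apply: cvgD => //; exact: cvg_cst.
have cV : (k%:R + p.1 - p.2)^-1 @[p --> q] --> (k%:R + q.1 - q.2)^-1.
  by apply: cvgV => //; rewrite gt_eqF.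
have e1 : 1 / (k%:R + p.1 - p.2) @[p --> q] --> 1 / (k%:R + q.1 - q.2).
  by apply: cvgM => //; exact: cvg_cst.
have e2 : p.1 / (k%:R + p.1 - p.2) @[p --> q] --> q.1 / (k%:R + q.1 - q.2).
  exact: cvgM.
have Wn : nbhs q (unrenorm k @^-1` W).
  exact: (cvg_pair e1 e2 Wq).
have dn : nbhs q [set p | 0 < k%:R + p.1 - p.2].
  by apply: (cd [set x | 0 < x]); exact: lt_nbhsr.
have [p [Ep [Wp dp]]] := clq _ (filterI Wn dn).
by exists (unrenorm k p); split => //; exact: eventually_flip_pos_unrenorm.
Qed.

Lemma ball_pairE (R : realType) (p q : R * R) (e : R) :
  `|p.1 - q.1| < e -> `|p.2 - q.2| < e -> ball p e q.
Proof. by move=> h1 h2; split; rewrite -ball_normE /=. Qed.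

(** Near the corner, in homogeneous coordinates (1, 1 - a, a - b), H_1 acts by
    (1, s, s) |-> (1 + s, s, s) on the line 1 - a = a - b.  Starting from
    s = 2/3 this produces s = 2 / (3 + 2 n). *)
Lemma closure_corner (R : realType) : closure eventually_flip_pos ((1, 1) : R * R).
Proof.
pose pt n : R * R := (1 - 2 / (3 + 2 * n%:R), 1 - 4 / (3 + 2 * n%:R)).
have ptS n : unrenorm 1 (pt n) = pt n.+1.
  have n0 : (0 : R) <= n%:R by exact: ler0n.
  rewrite /unrenorm /pt /= -natr1.
  by congr (_, _); field; rewrite !gt_eqF //; lra.
have pt_flip n : eventually_flip (pt n).
  elim: n => [|n IH].
    exists flip_domain; first exact: renormalizable_flip.
    by rewrite /pt mulr0 addr0; split => /=; lra.
  rewrite -ptS; apply: eventually_flip_posW.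
  apply: eventually_flip_pos_unrenorm => //=.
  have n0 : 0 < 3 + 2 * n%:R :> R by have := ler0n R n; lra.
  have := n0; rewrite -invr_gt0; move: (_^-1) => v v0.
  by rewrite mulr1n; lra.
move=> W /nbhs_ballP[e /= e0 eW].
pose n := Num.truncn (2 / e).
exists (pt n.+1); split.
  rewrite -ptS; apply: eventually_flip_pos_unrenorm => //=.
  have n0 : 0 < 3 + 2 * n%:R :> R by have := ler0n R n; lra.
  have := n0; rewrite -invr_gt0; move: (_^-1) => v v0.
  by rewrite mulr1n; lra.
have ne : 2 < e * n.+1%:R.
  by have := truncnS_gt (2 / e); rewrite ltr_pdivrMr // mulrC.
have n0 : 0 < n.+1%:R :> R by rewrite ltr0n.
have D0 : 0 < 3 + 2 * n.+1%:R :> R by lra.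
have small : 4 / (3 + 2 * n.+1%:R) < e by rewrite ltr_pdivrMr //; lra.
have pos : 0 < 2 / (3 + 2 * n.+1%:R) :> R by exact: divr_gt0.
have E : 4 / (3 + 2 * n.+1%:R) = 2 * (2 / (3 + 2 * n.+1%:R)) :> R by ring.
by apply/eW/ball_pairE; rewrite /= opprB addrCA subrr addr0 ger0_norm; lra.
Qed.

(** Induction on the size of the triple.  If z <= x mod y, the renormalized
    second coordinate is at most 0 and lowering it slightly lands in
    [flip_domain]; otherwise the renormalized triple is again positive. *)
Lemma closure_rational (R : realType) (x y z : nat) :
  (0 < z)%N -> (z <= y)%N -> (y <= x)%N ->
  closure eventually_flip_pos ((y%:R / x%:R, z%:R / x%:R) : R * R).
Proof.
have [N] := ubnP (x + y + z)%N.
elim: N x y z => [//|N IH] x y z; rewrite ltnS => xyzN z0 zy yx.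
have y0 : (0 < y)%N := leq_trans z0 zy.
have x0 : (0 < x)%N := leq_trans y0 yx.
have yR : (0 : R) < y%:R by rewrite ltr0n.
have xR : (0 : R) < x%:R by rewrite ltr0n.
set k := (x %/ y)%N; set r := (x %% y)%N.
have k0 : (0 < k)%N by rewrite divn_gt0.
have ry : (r < y)%N by rewrite ltn_mod.
have xE : x%:R = k%:R * y%:R + r%:R :> R.
  by rewrite {1}(divn_eq x y) natrD natrM.
pose q : R * R := (z%:R / y%:R, (z%:R - r%:R) / y%:R).
have dE : k%:R + q.1 - q.2 = x%:R / y%:R.
  by rewrite /q /= xE; field; rewrite gt_eqF.
have -> : (y%:R / x%:R, z%:R / x%:R) = unrenorm k q.
  rewrite /unrenorm dE; congr (_, _) => /=; first by rewrite div1r invf_div.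
  by field; rewrite !gt_eqF.
apply: closure_unrenorm => //; first by rewrite dE divr_gt0.
have [zr|rz] := leqP z r.
  move=> W /nbhs_ballP[e /= e0 eW].
  have rR : (r%:R : R) < y%:R by rewrite ltr_nat.
  have zR : (z%:R : R) <= r%:R by rewrite ler_nat.
  have z0R : (0 : R) < z%:R by rewrite ltr0n.
  pose c : R := (y%:R - r%:R) / y%:R.
  have c0 : 0 < c by rewrite divr_gt0 // subr_gt0.
  (* the gap c between q.2 and the lower edge q.1 - 1 of the domain *)
  pose d := Num.min (e / 2) (c / 2).
  have d0 : 0 < d by rewrite lt_min; apply/andP; split; exact: divr_gt0.
  have de : d <= e / 2 by rewrite /d ge_min lexx.
  have dc : d <= c / 2 by rewrite /d ge_min lexx orbT.
  exists (q.1, q.2 - d); split.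
    exists flip_domain; first exact: renormalizable_flip.
    have cE : q.2 = q.1 - 1 + c by rewrite /q /c /=; field; rewrite gt_eqF.
    split => /=.
    - by rewrite divr_gt0.
    - by rewrite ltr_pdivrMr // mul1r; lra.
    - by rewrite -/q.1 -/q.2; move: cE; rewrite /q /=; lra.
    - have : q.2 <= 0 by rewrite /q /= pmulr_lle0 ?invr_gt0 // subr_le0.
      by rewrite /q /=; lra.
  apply/eW/ball_pairE; first by rewrite /= subrr normr0.
  by rewrite /= opprB addrCA subrr addr0 gtr0_norm //; lra.
apply: (closure_subset (@eventually_flip_posW R)).
have [xz|xz] := leqP x (z - r).
  have xzE : z = x by apply/eqP; rewrite eqn_leq (leq_trans zy yx) (leq_trans xz) ?leq_subr.
  have yE : y = x by apply/eqP; rewrite eqn_leq yx -{1}xzE zy.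
  have rE : r = 0%N by rewrite /r yE modnn.
  have -> : q = (1, 1).
    by rewrite /q rE subr0 xzE yE divff // gt_eqF.
  exact: closure_corner.
rewrite /q -natrB ?(ltnW rz) //; apply: IH; last exact: zy.
- apply: leq_trans xyzN; by rewrite -[leqRHS]addnA [leqRHS]addnC ltn_add2l.
- by rewrite subn_gt0.
- exact: leq_subr.
Qed.

Lemma approx_nat (R : realType) (N : nat) (a : R) : 0 <= a -> a <= 1 ->
  `|a - (Num.truncn (a * N%:R)).+1%:R / N.+1%:R| <= N.+1%:R^-1.
Proof.
move=> a0 a1; have N0 : (0 : R) < N.+1%:R by rewrite ltr0n.
have /andP[m0 m1] : (Num.truncn (a * N%:R))%:R <= a * N%:R
    < (Num.truncn (a * N%:R)).+1%:R by apply: truncn_itv; rewrite mulr_ge0.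
set m := Num.truncn _ in m0 m1 *.
have -> : a - m.+1%:R / N.+1%:R = (a * N%:R + a - m.+1%:R) / N.+1%:R.
  by rewrite -[N.+1%:R in RHS]natr1 -natr1; field; rewrite natr1 gt_eqF.
rewrite normrM [`|_^-1|]gtr0_norm ?invr_gt0 // ler_piMl ?invr_ge0 ?ler0n //.
by move: m1; rewrite -natr1 ler_norml => m1; apply/andP; split; lra.
Qed.

Theorem theorem8p1 (R : realType) :
  triangle `<=` closure [set p : R * R | triangle p /\ stable p].
Proof.
move=> [a b] [/= b0 [ba a1]].
apply: (closure_subset (@eventually_flip_pos_stable R)).
rewrite (_ : closure eventually_flip_pos = closure (closure eventually_flip_pos)); last first.
  by apply/closure_id; exact: closed_closure.
move=> W /nbhs_ballP[e /= e0 eW].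
pose N := Num.truncn e^-1.
have Ne : N.+1%:R^-1 < e.
  by rewrite -[e]invrK ltf_pV2 ?posrE ?invr_gt0 // truncnS_gt.
(* numerators rounded up to be positive; the denominator N + 1 keeps them at
   most 1 after division *)
exists ((Num.truncn (a * N%:R)).+1%:R / N.+1%:R,
        (Num.truncn (b * N%:R)).+1%:R / N.+1%:R); split.
  apply: closure_rational => //.
    by rewrite ltnS le_truncn // ler_wpM2r.
  rewrite ltnS -(ler_nat R); apply: (@le_trans _ _ (a * N%:R)).
    have /andP[//] : (Num.truncn (a * N%:R))%:R <= a * N%:R
      < (Num.truncn (a * N%:R)).+1%:R by apply: truncn_itv; rewrite mulr_ge0 //; lra.
  by rewrite ler_piMl.
by apply/eW/ball_pairE => /=; apply: le_lt_trans Ne; apply: approx_nat; lra.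
Qed.
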